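(* Let $(M,g)$ be a semi-Riemannian manifold of dimension $n\ge3$ satisfying $P\cdot\mathcal S=L\,Q(g,\mathcal S)$ for some $L\in C^\infty(M)$. Then: (i) $S\wedge S=g\wedge S^2$. (ii) $n^2S^2-2n\kappa S+\kappa^2g=0$ and $\kappa^{(2)}=\frac{\kappa^2}{n}$. Moreover, if $M$ is a Riemannian manifold, then $M$ is an Einstein manifold. (iii) $(n-1)E=L(n-1)\kappa\, g+(\kappa-L(n-1)n)\,S-S^2$.
   Context: $(M,g)$ is a connected smooth semi-Riemannian manifold of dimension $n\ge 3$; $R$ is the $(0,4)$ Riemann curvature tensor, with the sign convention that the Ricci tensor $S(X_2,X_3)$ is the $g$-trace of $R(X_1,X_2,X_3,X_4)$ over $X_1,X_4$; $\kappa$ is the scalar curvature; $\mathcal S$ is the Ricci operator, $g(\mathcal SX,Y)=S(X,Y)$, $S^2(X,Y)=g(\mathcal S^2X,Y)$, $\kappa^{(2)}=\mathrm{trace}(\mathcal S^2)$. $E(X,Y)$ is the $(0,2)$-tensor obtained by contracting $R(X_1,X,Y,\mathcal SX_2)$ over $X_1,X_2$. Einstein means $S=\frac{\kappa}{n}g$. Projective curvature tensor: $P(X_1,X_2,X_3,X_4)=R(X_1,X_2,X_3,X_4)-\frac{1}{n-1}\left[S(X_2,X_3)g(X_1,X_4)-S(X_1,X_3)g(X_2,X_4)\right]$, with $(1,3)$-version $\mathcal P$ given by $g(\mathcal P(X,Y)X_1,X_2)=P(X,Y,X_1,X_2)$. $(P\cdot\mathcal S)(X_1,X,Y)=\mathcal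 P(X,Y)\mathcal SX_1-\mathcal S(\mathcal P(X,Y)X_1)$, and $Q(g,\mathcal S)(X_1,X,Y)=(X\wedge_gY)\mathcal SX_1-\mathcal S((X\wedge_gY)X_1)$, where $(X\wedge_gY)Z=g(Y,Z)X-g(X,Z)Y$. Kulkarni–Nomizu product: $(A\wedge F)(X_1,X_2,X_3,X_4)=A(X_1,X_4)F(X_2,X_3)+A(X_2,X_3)F(X_1,X_4)-A(X_1,X_3)F(X_2,X_4)-A(X_2,X_4)F(X_1,X_3)$. *)

(* Defs.v *)
From HB Require Import structures.
From mathcomp Require Import all_boot all_order all_algebra.
From mathcomp Require Import all_classical all_reals all_analysis.

Set Implicit Arguments.
Unset Strict Implicit.
Unset Printing Implicit Defensive.

Import Order.TTheory GRing.Theory Num.Theory.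
Import numFieldNormedType.Exports.
Local Open Scope classical_set_scope.
Local Open Scope ring_scope.

(* [iter_partial [:: i1; ..; ik] f] is d_{i1} (.. (d_{ik} f)). *)
Definition iter_partial (R : realType) (n : nat) (W : normedModType R)
    (s : seq 'I_n) (f : 'rV[R]_n -> W) : 'rV[R]_n -> W :=
  foldr (fun i h => fun x => 'D_('e_i) h x) f s.

(* C^oo on U (used for open U only): all iterated partial derivatives exist
   and are continuous at every point of U. *)
Definition smooth_on (R : realType) (n : nat) (W : normedModType R)
    (U : set 'rV[R]_n) (f : 'rV[R]_n -> W) : Prop :=
  forall (s : seq 'I_n) (x : 'rV[R]_n), U x ->
    {for x, continuous (iter_partial s f)} /\
    (forall i : 'I_n, derivable (iter_partial s f) x 'e_i).

(* A homeomorphism from an open subset of M onto an open subset of R^n; the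
   values of [chart_map] outside [chart_dom] and of [chart_inv] outside
   [chart_img] are irrelevant. *)
Record chart (R : realType) (n : nat) (M : topologicalType) := Chart {
  chart_dom : set M;
  chart_map :> M -> 'rV[R]_n;
  chart_inv : 'rV[R]_n -> M;
  chart_dom_open : open chart_dom;
  chart_img_open : open (chart_map @` chart_dom);
  chart_mapK : forall p, chart_dom p -> chart_inv (chart_map p) = p;
  chart_map_continuous :
    forall p, chart_dom p -> {for p, continuous chart_map};
  chart_inv_continuous :
    forall p, chart_dom p -> {for chart_map p, continuous chart_inv}
}.

Definition chart_img (R : realType) (n : nat) (M : topologicalType)
    (c : chart R n M) : set 'rV[R]_n := c @` chart_dom c.

Definition overlap_img (R : realType) (n : nat) (M : topologicalType)
    (c d : chart R n M) : set 'rV[R]_n := c @` (chart_dom c `&` chart_dom d).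

Definition transition (R : realType) (n : nat) (M : topologicalType)
    (c d : chart R n M) : 'rV[R]_n -> 'rV[R]_n := d \o chart_inv c.

(* The structure of a connected smooth n-dimensional manifold on M, given by an
   atlas that need not be maximal. *)
Record smooth_manifold (R : realType) (n : nat) (M : topologicalType) :=
  SmoothManifold {
  manifold_hausdorff : hausdorff_space M;
  manifold_second_countable : @second_countable M;
  manifold_connected : connected [set: M];
  atlas : set (chart R n M);
  atlas_cover : forall p : M, exists2 c, atlas c & chart_dom c p;
  atlas_smooth : forall c d, atlas c -> atlas d ->
    smooth_on (overlap_img c d) (transition c d)
}.

Definition smooth_function (R : realType) (n : nat) (M : topologicalType)
    (A : smooth_manifold R n M) (f : M -> R) : Prop :=
  forall c, atlas A c -> smooth_on (chart_img c) (f \o chart_inv c).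

(* A smooth symmetric nondegenerate (0,2)-tensor field, given by its component
   matrices [metric c x] at the point with coordinates x in the chart c, with
   the tensorial transformation rule.  Tangent vectors are row vectors of
   components in the coordinate frame, and v *m 'J f x is the image of v under
   the differential of f at x.  The index is not mentioned: it is locally
   constant, hence constant on a connected manifold. *)
Record semi_riemannian_metric (R : realType) (n : nat) (M : topologicalType)
    (A : smooth_manifold R n M) := SemiRiemannianMetric {
  metric :> chart R n M -> 'rV[R]_n -> 'M[R]_n;
  metric_sym : forall c x, atlas A c -> chart_img c x ->
    (metric c x)^T = metric c x;
  metric_nondeg : forall c x, atlas A c -> chart_img c x ->
    metric c x \in unitmx;
  metric_smooth : forall c, atlas A c -> forall i j : 'I_n,
    smooth_on (chart_img c) (fun x => metric c x i j);
  metric_change : forall c d x, atlas A c -> atlas A d -> overlap_img c d x ->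
    metric c x = 'J (transition c d) x *m metric d (transition c d x)
                   *m ('J (transition c d) x)^T
}.

Definition kulkarni_nomizu (R : realType) (V : Type) (A F : V -> V -> R)
    (X1 X2 X3 X4 : V) : R :=
  A X1 X4 * F X2 X3 + A X2 X3 * F X1 X4
  - A X1 X3 * F X2 X4 - A X2 X4 * F X1 X3.

Section LocalGeometry.
(* G is the matrix field of a metric in one coordinate chart; x is the
   coordinate vector of the point at which a tensor is evaluated. *)
Variables (R : realType) (n : nat) (G : 'rV[R]_n -> 'M[R]_n).
Implicit Types (x u v w z : 'rV[R]_n) (i j k l : 'I_n).

Definition inner x u v : R := (u *m G x *m v^T) 0 0.

(* Christoffel symbols, Gamma^k_ij. *)
Definition christoffel x k i j : R :=
  2^-1 * \sum_l invmx (G x) k l *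
    ('D_('e_i) (fun y => G y j l) x + 'D_('e_j) (fun y => G y i l) x
     - 'D_('e_l) (fun y => G y i j) x).

(* Levi-Civita connection. *)
Definition nabla (X Y : 'rV[R]_n -> 'rV[R]_n) : 'rV[R]_n -> 'rV[R]_n :=
  fun x => 'D_(X x) Y x
    + \row_k \sum_i \sum_j X x 0 i * Y x 0 j * christoffel x k i j.

Definition bracket (X Y : 'rV[R]_n -> 'rV[R]_n) : 'rV[R]_n -> 'rV[R]_n :=
  fun x => 'D_(X x) Y x - 'D_(Y x) X x.

Definition curvature_field (X Y Z : 'rV[R]_n -> 'rV[R]_n) :
    'rV[R]_n -> 'rV[R]_n :=
  fun x => nabla X (nabla Y Z) x - nabla Y (nabla X Z) x
           - nabla (bracket X Y) Z x.

Definition coord_field i : 'rV[R]_n -> 'rV[R]_n := fun=> 'e_i.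

(* R(u, v) w: the tensor with components R(d_i, d_j) d_k in the coordinate
   frame, extended multilinearly. *)
Definition curvature_op x u v w : 'rV[R]_n :=
  \sum_i \sum_j \sum_k (u 0 i * v 0 j * w 0 k) *:
    curvature_field (coord_field i) (coord_field j) (coord_field k) x.

Definition riemann x u v w z : R := inner x (curvature_op x u v w) z.

(* g-trace of a bilinear form on the tangent space: g^{ij} B_ij. *)
Definition gtrace x (B : 'rV[R]_n -> 'rV[R]_n -> R) : R :=
  \sum_i \sum_j invmx (G x) i j * B 'e_i 'e_j.

(* The tangent vector a with g(a, w) = alpha(w) for all w; see [inner_sharp]. *)
Definition sharp x (alpha : 'rV[R]_n -> R) : 'rV[R]_n :=
  (\row_i alpha 'e_i) *m invmx (G x).

Lemma inner_sharp x (alpha : {linear 'rV[R]_n -> R}) w :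
  G x \in unitmx -> inner x (sharp x alpha) w = alpha w.
Proof.
move=> Gx; rewrite /inner /sharp mulmxKV // mxE.
rewrite {2}(row_sum_delta w) linear_sum /=; apply: eq_bigr => i _.
by rewrite !mxE linearZ /= mulrC.
Qed.

Definition ricci x u v : R := gtrace x (fun X1 X4 => riemann x X1 u v X4).

Definition scalar_curvature x : R := gtrace x (ricci x).

Definition ricci_op x u : 'rV[R]_n := sharp x (ricci x u).

(* S^2 *)
Definition ricci2 x u v : R := inner x (ricci_op x (ricci_op x u)) v.

(* kappa^(2); [lin1_mx f] is the matrix of the linear map f. *)
Definition scalar_curvature2 x : R :=
  \tr (lin1_mx (fun u => ricci_op x (ricci_op x u))).

(* E *)
Definition e_tensor x u v : R :=
  gtrace x (fun X1 X2 => riemann x X1 u v (ricci_op x X2)).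

Definition projective x X1 X2 X3 X4 : R :=
  riemann x X1 X2 X3 X4
  - (n%:R - 1)^-1 * (ricci x X2 X3 * inner x X1 X4
                     - ricci x X1 X3 * inner x X2 X4).

Definition projective_op x X Y X1 : 'rV[R]_n := sharp x (projective x X Y X1).

Definition projective_dot_ricci x X1 X Y : 'rV[R]_n :=
  projective_op x X Y (ricci_op x X1) - ricci_op x (projective_op x X Y X1).

Definition wedge_g x X Y Z : 'rV[R]_n := inner x Y Z *: X - inner x X Z *: Y.

(* Q(g, S) for the Ricci operator S. *)
Definition q_g_ricci x X1 X Y : 'rV[R]_n :=
  wedge_g x X Y (ricci_op x X1) - ricci_op x (wedge_g x X Y X1).

End LocalGeometry.

Section GlobalConditions.
Variables (R : realType) (n : nat) (M : topologicalType).
Variables (A : smooth_manifold R n M) (g : semi_riemannian_metric A).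

Definition riemannian : Prop :=
  forall c p, atlas A c -> chart_dom c p ->
  forall v : 'rV[R]_n, v != 0 -> 0 < inner (g c) (c p) v v.

Definition einstein : Prop :=
  forall c p, atlas A c -> chart_dom c p ->
  forall X Y : 'rV[R]_n,
    ricci (g c) (c p) X Y
    = scalar_curvature (g c) (c p) / n%:R * inner (g c) (c p) X Y.

End GlobalConditions.

(* Main.v *)
(* At a point everything is linear algebra.  Lowering an index, the condition reads
   R(X,Y,SX1,X2) - R(X,Y,X1,SX2) - B(X1,X2)/(n-1) = L Q(g,S)(X1,X,Y;X2), where
   B(X1,X2) = S^2(Y,X1) g(X,X2) - S^2(X,X1) g(Y,X2) - S(Y,X1) S(X,X2) + S(X,X1) S(Y,X2).
   By the skew symmetry of R in its last two arguments, the curvature part is symmetric in X1, X2,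
   and so is Q(g,S); hence the part of B that is skew in X1, X2 vanishes, which is (i).
   Contracting (i) over X1, X4 gives n S^2 - 2 kappa S + kappa^(2) g = 0, and a second
   trace gives kappa^(2) = kappa^2/n.  Then N = n S - kappa satisfies g(NX, NX) = 0, so
   N = 0 when g is definite.  Contracting the condition over X, X2 gives (iii).

   The symmetries of R follow from its expression in coordinates,
   R_ijkl = 1/2 (d_i d_k g_jl - d_i d_l g_jk - d_j d_k g_il + d_j d_l g_ik)
            - <Gamma_jk, Gamma_il> + <Gamma_ik, Gamma_jl>,
   where the second partial derivatives of the metric commute. *)
Require Import Defs.
From HB Require Import structures.
From mathcomp Require Import all_boot all_order all_algebra.
From mathcomp Require Import all_classical all_reals all_analysis.
From mathcomp Require Import ring lra.
Import Order.TTheory GRing.Theory Num.Theory.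
Import numFieldNormedType.Exports.
Local Open Scope classical_set_scope.
Local Open Scope ring_scope.

Set Implicit Arguments.
Unset Strict Implicit.
Unset Printing Implicit Defensive.

(** * Symmetry of mixed directional derivatives *)

Section MixedPartials.
Variables (R : realType) (V : normedModType R).
Implicit Types (f : V -> R) (x y u v : V).

(** The two difference quotients are the same function of [h], so directional derivability of [f]
    suffices and no chain rule enters. *)
Lemma is_derive_line f y u (s : R) : derivable f (y + s *: u) u ->
  is_derive s 1 (fun t => f (y + t *: u)) ('D_u f (y + s *: u)).
Proof.
have quotE : (fun h => h^-1 *: (((fun t => f (y + t *: u)) \o shift s) (h *: 1)
      - f (y + s *: u)))
    = (fun h => h^-1 *: ((f \o shift (y + s *: u)) (h *: u) - f (y + s *: u))).
  apply/funext => h /=; congr (_ *: (f _ - _)).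
  by rewrite [h *: 1]mulr1 scalerDl addrCA.
by move=> df; split; rewrite /derivable /derive quotE.
Qed.

(* The mean value theorem in the direction u, then in the direction v. *)
Lemma second_difference f x u v (h : R) : 0 < h ->
  (forall s t, 0 <= s <= h -> 0 <= t <= h ->
     derivable f (x + s *: u + t *: v) u
     /\ derivable ('D_u f) (x + s *: u + t *: v) v) ->
  exists s t, [/\ 0 <= s <= h, 0 <= t <= h &
    f (x + h *: u + h *: v) - f (x + h *: u) - f (x + h *: v) + f x
    = h ^+ 2 * 'D_v ('D_u f) (x + s *: u + t *: v)].
Proof.
move=> h0 df.
have zh : 0 <= (0 : R) <= h by rewrite lexx ltW.
have hh : 0 <= h <= h by rewrite lexx ltW.
have oo s : s \in `]0, h[ -> 0 <= s <= h.
  by rewrite in_itv /= => /andP[s0 sh]; rewrite !ltW.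
have cc s : s \in `[0, h] -> 0 <= s <= h by rewrite in_itv.
(* The second difference is [phi h - phi 0], and the derivative of [phi] is an increment of ['D_u f]
   in the direction [v], to which the mean value theorem applies again. *)
pose phi := (fun s => f (x + h *: v + s *: u)) - (fun s => f (x + s *: u)).
have dphi s : 0 <= s <= h -> is_derive s 1 phi
    ('D_u f (x + s *: u + h *: v) - 'D_u f (x + s *: u)).
  move=> sh; rewrite addrAC; apply: is_deriveB; apply: is_derive_line.
    by rewrite addrAC; exact: (df _ _ sh hh).1.
  by move: (df _ _ sh zh).1; rewrite scale0r addr0; exact.
have [s] := @MVT _ phi
    (fun s => 'D_u f (x + s *: u + h *: v) - 'D_u f (x + s *: u)) _ _ h0
    (fun s sI => dphi s (oo s sI))
    (derivable_within_continuous (fun s sI =>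
       @ex_derive _ _ _ _ _ _ _ (dphi s (cc s sI)))).
move=> /oo sh phiE.
have dpsi t : 0 <= t <= h -> is_derive t 1 (fun t => 'D_u f (x + s *: u + t *: v))
    ('D_v ('D_u f) (x + s *: u + t *: v)).
  by move=> th; apply: is_derive_line; exact: (df _ _ sh th).2.
have [t] := @MVT _ _ (fun t => 'D_v ('D_u f) (x + s *: u + t *: v)) _ _ h0
    (fun s sI => dpsi s (oo s sI))
    (derivable_within_continuous (fun s sI =>
       @ex_derive _ _ _ _ _ _ _ (dpsi s (cc s sI)))).
move=> /oo th psiE.
exists s, t; split=> //.
move: psiE phiE; rewrite /phi !fctE !scale0r !addr0 => -> .
rewrite [x + h *: v + h *: u]addrAC subr0 => E.
rewrite -(mulrC h) in E.
by rewrite expr2; lra.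
Qed.

(** The second difference is symmetric in [u] and [v], so the two mixed derivatives take a common
    value at two possibly different points near [x]; by continuity that value is within [e / 2] of
    each of them at [x]. *)
Theorem mixed_derive_comm f x u v :
  (\near x, [/\ derivable f x u, derivable f x v,
     derivable ('D_u f) x v & derivable ('D_v f) x u]) ->
  {for x, continuous ('D_v ('D_u f))} -> {for x, continuous ('D_u ('D_v f))} ->
  'D_v ('D_u f) x = 'D_u ('D_v f) x.
Proof.
move=> dnear cuv cvu; apply/eqP; rewrite -subr_eq0 -normr_le0.
apply/ler_addgt0Pl => e e0; rewrite addr0.
have e20 : 0 < e / 2 by rewrite divr_gt0.
have /cvgrPdist_le /(_ _ e20) nuv := cuv.
have /cvgrPdist_le /(_ _ e20) nvu := cvu.
have : nbhs x ([set y | [/\ derivable f y u, derivable f y v,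
     derivable ('D_u f) y v & derivable ('D_v f) y u]] `&`
   ([set y | `|'D_v ('D_u f) x - 'D_v ('D_u f) y| <= e / 2] `&`
    [set y | `|'D_u ('D_v f) x - 'D_u ('D_v f) y| <= e / 2])).
  exact: filterI dnear (filterI nuv nvu).
move=> /nbhs_ballP[r /= r0 rP].
(* With this step the whole parallelogram stays in the ball of radius [r]; the summand 1 keeps the
   divisor positive when [u] and [v] vanish. *)
pose h := r / 2 / (`|u| + `|v| + 1).
have uv0 : 0 < `|u| + `|v| + 1 by rewrite ltr_wpDl // addr_ge0.
have h0 : 0 < h by rewrite !divr_gt0.
have inb s t : 0 <= s <= h -> 0 <= t <= h -> ball x r (x + s *: u + t *: v).
  move=> /andP[s0 sh] /andP[t0 th].
  rewrite -ball_normE /ball_ /= -addrA opprD addrA subrr add0r normrN.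
  apply: (le_lt_trans (ler_normD _ _)); rewrite !normrZ !ger0_norm //.
  have : h * (`|u| + `|v| + 1) = r / 2 by rewrite /h divfK // gt_eqF.
  have := ler_wpM2r (normr_ge0 u) sh; have := ler_wpM2r (normr_ge0 v) th.
  by rewrite !mulrDr; lra.
have [s [t [sh th E1]]] : exists s t, [/\ 0 <= s <= h, 0 <= t <= h &
    f (x + h *: u + h *: v) - f (x + h *: u) - f (x + h *: v) + f x
    = h ^+ 2 * 'D_v ('D_u f) (x + s *: u + t *: v)].
  apply: (second_difference h0) => s t sh th.
  by have [[d1 d2 d3 d4] _] := rP _ (inb _ _ sh th); exact: conj d1 d3.
have [t' [s' [th' sh' E2]]] : exists s t, [/\ 0 <= s <= h, 0 <= t <= h &
    f (x + h *: v + h *: u) - f (x + h *: v) - f (x + h *: u) + f x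
    = h ^+ 2 * 'D_u ('D_v f) (x + s *: v + t *: u)].
  apply: (second_difference h0) => t1 s1 th1 sh1; rewrite addrAC.
  by have [[d1 d2 d3 d4] _] := rP _ (inb _ _ sh1 th1); exact: conj d2 d4.
move: (rP _ (inb _ _ sh th)).2.1 (rP _ (inb _ _ sh' th')).2.2 => /=.
(* Reordering the increments gives both second differences the same terms, so [h ^+ 2] can be
   cancelled. *)
move: E1 E2; rewrite [x + h *: v + h *: u]addrAC [x + t' *: v + _]addrAC.
move: ('D_v ('D_u f) (x + _ + _)) ('D_u ('D_v f) (x + _ + _)) => a b.
move: ('D_v ('D_u f) x) ('D_u ('D_v f) x) (f (x + _ + _)) => a0 b0 d Ea Eb.
have -> : b = a.
  apply: (@mulfI _ (h ^+ 2)); first by rewrite expf_neq0 // gt_eqF.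
  by rewrite -Ea -Eb (addrAC d).
move=> da db; rewrite (splitr e); apply: le_trans (ler_distD a _ _) _.
by apply: lerD; rewrite // distrC.
Qed.

End MixedPartials.

(** * Differentiability of sums, products, determinants and inverse matrices *)

Section DerivableMatrix.
Variables (R : realType) (V : normedModType R).
Implicit Types (x v : V).

Lemma derivable_bigsum (I : Type) (r : seq I) (P : pred I) (F : I -> V -> R) x v :
  (forall i, derivable (F i) x v) ->
  derivable (fun y => \sum_(i <- r | P i) F i y) x v.
Proof.
move=> dF; elim: r => [|i r IHr].
  by under eq_fun do rewrite big_nil; exact: derivable_cst.
under eq_fun do rewrite big_cons; case: (P i); last exact: IHr.
exact: (derivableD (dF i) IHr).
Qed.

Lemma derive_bigsum n (F : 'I_n -> V -> R) x v :
  (forall i, derivable (F i) x v) ->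
  'D_v (fun y => \sum_i F i y) x = \sum_i 'D_v (F i) x.
Proof.
move=> dF; rewrite -derive_sum //; congr ('D_v _ x).
by apply/funext => y; rewrite fct_sumE.
Qed.

Lemma derivable_bigprod (I : Type) (r : seq I) (P : pred I) (F : I -> V -> R) x v :
  (forall i, derivable (F i) x v) ->
  derivable (fun y => \prod_(i <- r | P i) F i y) x v.
Proof.
move=> dF; elim: r => [|i r IHr].
  by under eq_fun do rewrite big_nil; exact: derivable_cst.
under eq_fun do rewrite big_cons; case: (P i); last exact: IHr.
exact: (derivableM (dF i) IHr).
Qed.

Lemma derivable_det n (A : V -> 'M[R]_n) x v :
  (forall i j, derivable (fun y => A y i j) x v) ->
  derivable (fun y => \det (A y)) x v.
Proof.
move=> dA; rewrite /determinant; apply: derivable_bigsum => s.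
apply: (derivableM (derivable_cst _ _ _)).
by apply: derivable_bigprod => i; exact: dA.
Qed.

(** By the cofactor formula each entry is a quotient of determinants. At a singular matrix [invmx]
    returns its argument, so the formula is used only near [x]. *)
Lemma derivable_invmx n (A : V -> 'M[R]_n) x v :
  (\near x, A x \in unitmx) ->
  (forall i j, derivable (fun y => A y i j) x v) ->
  forall i j, derivable (fun y => invmx (A y) i j) x v.
Proof.
move=> uA dA i j.
apply: (@near_eq_derivable _ _ _
  (fun y => (\det (A y))^-1 * ((-1) ^+ (j + i) * \det (row' j (col' i (A y)))))).
  by near=> y; rewrite /invmx ifT ?mxE //; near: y.
apply: derivableM.
  apply: derivableV; last exact: derivable_det.
  by have := nbhs_singleton uA; rewrite unitmxE unitfE.
apply: (derivableM (derivable_cst _ _ _)).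
apply: derivable_det => k l; under eq_fun do rewrite !mxE; exact: dA.
Unshelve. all: by end_near. Qed.

End DerivableMatrix.

(** * The Levi-Civita connection and its curvature in coordinates *)

Section LeviCivita.
Variables (R : realType) (n : nat) (G : 'rV[R]_n -> 'M[R]_n).
Implicit Types (x u v w z : 'rV[R]_n) (i j k l m p : 'I_n).

Local Notation coord := (@coord_field R n).
Local Notation Gamma m i j := (fun y => christoffel G y m i j).

(* Christoffel symbols of the first kind, Gamma_{l,ij}; [christoffel_pairing] is
   the inner product of Gamma^._ij and Gamma^._kl. *)
Definition christoffel_lower x l i j : R :=
  2^-1 * ('D_('e_i) (fun y => G y j l) x + 'D_('e_j) (fun y => G y i l) x
     - 'D_('e_l) (fun y => G y i j) x).

Definition christoffel_pairing x i j k l : R :=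
  \sum_m christoffel G x m i j * christoffel_lower x m k l.

Lemma sum_delta (F : 'I_n -> R) i : \sum_j ('e_i : 'rV[R]_n) 0 j * F j = F i.
Proof.
rewrite (bigD1 i) //= mxE !eqxx mul1r big1 ?addr0 // => j ji.
by rewrite mxE (negPf ji) mul0r.
Qed.

Lemma sum_delta_scale (W : lmodType R) (F : 'I_n -> W) i :
  \sum_j ('e_i : 'rV[R]_n) 0 j *: F j = F i.
Proof.
rewrite (bigD1 i) //= mxE !eqxx scale1r big1 ?addr0 // => j ji.
by rewrite mxE (negPf ji) scale0r.
Qed.

Lemma nabla_coordl i (Y : 'rV[R]_n -> 'rV[R]_n) x m : derivable Y x 'e_i ->
  nabla G (coord i) Y x 0 m
  = 'D_('e_i) (fun y => Y y 0 m) x + \sum_p Y x 0 p * christoffel G x m i p.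
Proof.
move=> dY; rewrite /nabla /coord_field derive_mx // !mxE; congr (_ + _).
under eq_bigr => k _ do under eq_bigr => l _ do rewrite -mulrA.
under eq_bigr => k _ do rewrite -mulr_sumr.
exact: sum_delta.
Qed.

(** An equality of functions, so that it can be rewritten under the outer covariant derivative in
    the curvature. *)
Lemma nabla_coord j k :
  nabla G (coord j) (coord k) = fun x => \row_m christoffel G x m j k.
Proof.
apply/funext => x; apply/rowP => m; rewrite nabla_coordl; last exact: derivable_cst.
by rewrite derive_cst add0r sum_delta mxE.
Qed.

Lemma curvature_op_coord x i j k :
  curvature_op G x 'e_i 'e_j 'e_k
  = curvature_field G (coord i) (coord j) (coord k) x.
Proof.
rewrite /curvature_op.
under eq_bigr => a _ do under eq_bigr => b _ do under eq_bigr => c _ do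
  rewrite -!scalerA.
under eq_bigr => a _ do under eq_bigr => b _ do rewrite -!scaler_sumr sum_delta_scale.
under eq_bigr => a _ do rewrite -scaler_sumr sum_delta_scale.
by rewrite sum_delta_scale.
Qed.

(** The classical coordinate formula: coordinate fields are constant, so their bracket vanishes and
    only the two iterated covariant derivatives remain. *)
Lemma curvature_field_coord x i j k m :
  (forall p, derivable (Gamma p j k) x 'e_i) ->
  (forall p, derivable (Gamma p i k) x 'e_j) ->
  curvature_field G (coord i) (coord j) (coord k) x 0 m
  = 'D_('e_i) (Gamma m j k) x
      + \sum_p christoffel G x p j k * christoffel G x m i p
    - ('D_('e_j) (Gamma m i k) x
      + \sum_p christoffel G x p i k * christoffel G x m j p).
Proof.
have drow a b c : (forall p, derivable (Gamma p b c) x 'e_a) ->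
    derivable (fun y => \row_p christoffel G y p b c) x 'e_a.
  move=> d; apply/derivable_mxP => a' p.
  by under eq_fun do rewrite mxE; exact: d.
move=> dj di; rewrite /curvature_field !nabla_coord.
have mxB (A B : 'rV[R]_n) : (A - B) 0 m = A 0 m - B 0 m by rewrite !mxE.
rewrite !mxB (nabla_coordl _ (drow _ _ _ dj)) (nabla_coordl _ (drow _ _ _ di)).
have -> : nabla G (bracket (coord i) (coord j)) (coord k) x = 0.
  rewrite /nabla derive_cst add0r; apply/rowP => p; rewrite !mxE.
  rewrite big1 // => a _; rewrite big1 // => b _.
  by rewrite /bracket !derive_cst subr0 mxE !mul0r.
rewrite [X in _ - X]mxE subr0.
have rowE b c : (fun y => (\row_p christoffel G y p b c) 0 m) = Gamma m b c.
  by apply/funext => y; rewrite mxE.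
have sumE a b c : \sum_p (\row_m christoffel G x m b c) 0 p * christoffel G x m a p
    = \sum_p christoffel G x p b c * christoffel G x m a p.
  by apply: eq_bigr => p _; rewrite mxE.
rewrite !sumE !rowE; reflexivity.
Qed.

(** * Symmetries of the curvature of a smooth metric on an open set *)

Variable U : set 'rV[R]_n.
Hypothesis openU : open U.
Hypothesis symG : forall x, U x -> (G x)^T = G x.
Hypothesis unitG : forall x, U x -> G x \in unitmx.
Hypothesis smoothG : forall i j, smooth_on U (fun x => G x i j).

Lemma sym_entry x i j : U x -> G x i j = G x j i.
Proof. by move=> Ux; rewrite -{1}(symG Ux) mxE. Qed.

Lemma near_domain x : U x -> \forall y \near x, U y.
Proof. by move=> Ux; exact: open_nbhs_nbhs. Qed.

Lemma derivable_metric x i j k : U x -> derivable (fun y => G y i j) x 'e_k.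
Proof. by move=> Ux; exact: (smoothG i j [::] Ux).2. Qed.

Lemma derivable2_metric x i j k l : U x ->
  derivable ('D_('e_l) (fun y => G y i j)) x 'e_k.
Proof. by move=> Ux; exact: (smoothG i j [:: l] Ux).2. Qed.

Lemma continuous2_metric x i j k l : U x ->
  {for x, continuous ('D_('e_k) ('D_('e_l) (fun y => G y i j)))}.
Proof. by move=> Ux; exact: (smoothG i j [:: k; l] Ux).1. Qed.

Lemma derive2_metric_comm x i j k l : U x ->
  'D_('e_k) ('D_('e_l) (fun y => G y i j)) x
  = 'D_('e_l) ('D_('e_k) (fun y => G y i j)) x.
Proof.
move=> Ux; apply: mixed_derive_comm; try exact: continuous2_metric.
near=> y; have Uy : U y by near: y; exact: near_domain.
by split; [exact: derivable_metric|exact: derivable_metric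
          |exact: derivable2_metric|exact: derivable2_metric].
Unshelve. all: by end_near. Qed.

(** The symmetry of [G] is known on [U] only; as [U] is open, the two entries agree near [x], which
    determines the derivative. *)
Lemma derive_metric_sym x i j k : U x ->
  'D_('e_k) (fun y => G y i j) x = 'D_('e_k) (fun y => G y j i) x.
Proof.
move=> Ux; apply: near_eq_derive; near=> y.
by apply: sym_entry; near: y; exact: near_domain.
Unshelve. all: by end_near. Qed.

Lemma derive2_metric_sym x i j k l : U x ->
  'D_('e_l) ('D_('e_k) (fun y => G y i j)) x
  = 'D_('e_l) ('D_('e_k) (fun y => G y j i)) x.
Proof.
move=> Ux; apply: near_eq_derive; near=> y.
by apply: derive_metric_sym; near: y; exact: near_domain.
Unshelve. all: by end_near. Qed.

(** The connection is torsion free. *)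
Lemma christoffel_sym x k i j : U x -> christoffel G x k i j = christoffel G x k j i.
Proof.
move=> Ux; rewrite /christoffel; congr (_ * _); apply: eq_bigr => l _.
by rewrite (derive_metric_sym i j) // [X in X - _]addrC.
Qed.

Lemma christoffel_lower_sym x k i j : U x ->
  christoffel_lower x k i j = christoffel_lower x k j i.
Proof.
move=> Ux; rewrite /christoffel_lower (derive_metric_sym i j) //.
by rewrite [X in X - _]addrC.
Qed.

Lemma christoffel_pairing_sym x i j k l : U x ->
  christoffel_pairing x i j k l = christoffel_pairing x j i l k.
Proof.
move=> Ux; apply: eq_bigr => m _.
by rewrite christoffel_sym // christoffel_lower_sym.
Qed.

Lemma christoffel_raise x m i j :
  christoffel G x m i j = \sum_l invmx (G x) m l * christoffel_lower x l i j.
Proof.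
rewrite /christoffel mulr_sumr; apply: eq_bigr => l _.
by rewrite /christoffel_lower mulrCA.
Qed.

Lemma christoffel_lowerE x l i j : U x ->
  \sum_m christoffel G x m i j * G x m l = christoffel_lower x l i j.
Proof.
move=> Ux; under eq_bigr => m _ do rewrite christoffel_raise mulr_suml.
rewrite exchange_big /= -[RHS](sum_delta (fun p => christoffel_lower x p i j)).
apply: eq_bigr => p _; under eq_bigr => m _ do rewrite mulrAC.
(* What remains is the [(l, p)] entry of [G x *m invmx (G x) = 1]. *)
rewrite -mulr_suml; congr (_ * _).
rewrite [RHS]mxE eqxx eq_sym /=.
have := congr1 (fun M : 'M[R]_n => M l p) (mulmxV (unitG Ux)).
rewrite /= !mxE => <-; apply: eq_bigr => m _.
by rewrite [G x m l]sym_entry // mulrC.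
Qed.

(** Compatibility of the connection with the metric: in the sum of the two symbols all derivatives
    but the one along ['e_i] cancel. *)
Lemma christoffel_lower_compat x i m l : U x ->
  'D_('e_i) (fun y => G y m l) x
  = christoffel_lower x l i m + christoffel_lower x m i l.
Proof.
move=> Ux; rewrite /christoffel_lower (derive_metric_sym l m) //.
rewrite (derive_metric_sym i m) // (derive_metric_sym i l) //.
by field.
Qed.

(** Writing the lower symbols through the upper ones turns both sides into the same double sum
    against the symmetric matrix [G x]. *)
Lemma christoffel_pairing_comm x i j k l : U x ->
  christoffel_pairing x i j k l = christoffel_pairing x k l i j.
Proof.
move=> Ux; rewrite /christoffel_pairing.
under eq_bigr => m _ do rewrite -christoffel_lowerE // mulr_sumr.
under [RHS]eq_bigr => m _ do rewrite -christoffel_lowerE // mulr_sumr.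
rewrite exchange_big; apply: eq_bigr => p _; apply: eq_bigr => m _ /=.
by rewrite mulrCA [G x p m]sym_entry.
Qed.

Lemma derivable_christoffel x m i j k : U x ->
  derivable (Gamma m i j) x 'e_k.
Proof.
move=> Ux; apply: (derivableM (derivable_cst _ _ _)).
apply: derivable_bigsum => l; apply: derivableM.
  apply: derivable_invmx => [|a b]; last exact: derivable_metric.
  by near=> y; apply: unitG; near: y; exact: near_domain.
by apply: derivableB; first apply: derivableD; exact: derivable2_metric.
Unshelve. all: by end_near. Qed.

Lemma derive_christoffel_lower x l i j k : U x ->
  'D_('e_k) (fun y => christoffel_lower y l i j) x
  = 2^-1 * ('D_('e_k) ('D_('e_i) (fun y => G y j l)) x
     + 'D_('e_k) ('D_('e_j) (fun y => G y i l)) x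
     - 'D_('e_k) ('D_('e_l) (fun y => G y i j)) x).
Proof.
move=> Ux; rewrite /christoffel_lower.
have d a b c := @derivable2_metric x a b k c Ux.
rewrite (@deriveZ _ _ _ ((('D_('e_i) (fun y => G y j l) + 'D_('e_j) (fun y => G y i l)))
     - 'D_('e_l) (fun y => G y i j))); last first.
  by apply: derivableB; [apply: derivableD|]; exact: d.
rewrite deriveB; [|by apply: derivableD; exact: d|exact: d].
by rewrite deriveD; [|exact: d|exact: d].
Qed.

(** The product rule for the lowered symbol, in which metric compatibility splits the derivative of
    [G]: one part forms the pairing, the other will cancel the quadratic terms of the curvature. *)
Lemma derive_christoffelM x l i j k : U x ->
  \sum_m 'D_('e_k) (Gamma m i j) x * G x m l
  = 'D_('e_k) (fun y => christoffel_lower y l i j) x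
    - (christoffel_pairing x i j k l
       + \sum_m christoffel G x m i j * christoffel_lower x l k m).
Proof.
move=> Ux.
have -> : 'D_('e_k) (fun y => christoffel_lower y l i j) x
    = 'D_('e_k) (fun y => \sum_m (Gamma m i j * (fun y => G y m l)) y) x.
  apply: near_eq_derive; near=> y; rewrite -christoffel_lowerE //.
  by near: y; exact: near_domain.
have dG m := @derivable_christoffel x m i j k Ux.
have dg m := @derivable_metric x m l k Ux.
rewrite derive_bigsum; last by move=> m; exact: derivableM.
rewrite /christoffel_pairing -big_split /= -sumrB; apply: eq_bigr => m _.
rewrite (deriveM (dG m) (dg m)) christoffel_lower_compat //.
set a := christoffel _ _ _ _ _; set d := 'D_ _ _ _; set p := christoffel_lower _ _ _ _.
set q := christoffel_lower _ _ _ _; rewrite /GRing.scale /=.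
move: a d p q (G x m l) => a d p q b; ring.
Unshelve. all: by end_near. Qed.

Lemma riemann_coefE x i j k l : U x ->
  riemann G x 'e_i 'e_j 'e_k 'e_l
  = 2^-1 * ('D_('e_i) ('D_('e_k) (fun y => G y j l)) x
            - 'D_('e_i) ('D_('e_l) (fun y => G y j k)) x
            - 'D_('e_j) ('D_('e_k) (fun y => G y i l)) x
            + 'D_('e_j) ('D_('e_l) (fun y => G y i k)) x)
    - christoffel_pairing x j k i l + christoffel_pairing x i k j l.
Proof.
move=> Ux; rewrite /riemann /inner curvature_op_coord.
set C := curvature_field _ _ _ _ _.
have -> : (C *m G x *m ('e_l : 'rV[R]_n)^T) 0 0 = \sum_m C 0 m * G x m l.
  rewrite mxE -(sum_delta (fun b => \sum_m C 0 m * G x m b) l).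
  by apply: eq_bigr => p _; rewrite mulrC; congr (_ * _); rewrite mxE.
under eq_bigr => m _.
  rewrite curvature_field_coord; try by move=> p; exact: derivable_christoffel.
  rewrite mulrBl !mulrDl.
  over.
(* Lowering the free index brings the quadratic terms to the form of the last sum in
   [derive_christoffelM], which they cancel. *)
have quad a b c : \sum_m (\sum_p christoffel G x p b c * christoffel G x m a p) * G x m l
   = \sum_m christoffel G x m b c * christoffel_lower x l a m.
  under eq_bigr => m _ do rewrite mulr_suml.
  rewrite exchange_big; apply: eq_bigr => p _ /=.
  by rewrite -christoffel_lowerE // mulr_sumr; apply: eq_bigr => m _; rewrite mulrA.
have combine (A1 B1 A2 B2 a1 b1 a2 b2 : R) : A1 = a1 -> B1 = b1 -> A2 = a2 ->
    B2 = b2 -> A1 + B1 - (A2 + B2) = a1 + b1 - (a2 + b2) by move=> -> -> -> ->.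
rewrite sumrB !big_split /=.
apply: (etrans (combine _ _ _ _ _ _ _ _ (derive_christoffelM l j k i Ux) (quad _ _ _)
  (derive_christoffelM l i k j Ux) (quad _ _ _))).
rewrite (derive_christoffel_lower l j k i Ux) (derive_christoffel_lower l i k j Ux).
(* The second derivatives of [G y k l] along ['e_i] and ['e_j] now cancel. *)
rewrite (derive2_metric_comm k l j i Ux).
move: ('D_ _ _ _) ('D_ _ _ _) ('D_ _ _ _) ('D_ _ _ _) ('D_ _ _ _).
move: (christoffel_pairing _ _ _ _ _) (christoffel_pairing _ _ _ _ _).
move: (\sum_m _) (\sum_m _) => S1 S2 P Q D1 D2 D3 D4 D5.
by field.
Qed.

(** Exchanging [k] and [l] reverses the sign of the second derivative part termwise and interchanges
    the two pairings, up to the symmetry of the inner product. *)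
Lemma riemann_skew_coord x i j k l : U x ->
  riemann G x 'e_i 'e_j 'e_k 'e_l = - riemann G x 'e_i 'e_j 'e_l 'e_k.
Proof.
move=> Ux; rewrite (riemann_coefE i j k l Ux) (riemann_coefE i j l k Ux).
rewrite (christoffel_pairing_comm j l i k Ux) (christoffel_pairing_comm i l j k Ux).
move: ('D_ _ _ _) ('D_ _ _ _) ('D_ _ _ _) ('D_ _ _ _).
by move: (christoffel_pairing _ _ _ _ _) (christoffel_pairing _ _ _ _ _) => *; ring.
Qed.

(** The second derivatives match after commuting the partials and transposing [G]; the pairings
    match by torsion freeness and the symmetry of the inner product. *)
Lemma riemann_pair_coord x i j k l : U x ->
  riemann G x 'e_i 'e_j 'e_k 'e_l = riemann G x 'e_k 'e_l 'e_i 'e_j.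
Proof.
move=> Ux; rewrite (riemann_coefE i j k l Ux) (riemann_coefE k l i j Ux).
rewrite (derive2_metric_comm l j k i Ux) (derive2_metric_sym l j k i Ux).
rewrite (derive2_metric_comm l i k j Ux) (derive2_metric_sym l i k j Ux).
rewrite (derive2_metric_comm k j l i Ux) (derive2_metric_sym k j l i Ux).
rewrite (derive2_metric_comm k i l j Ux) (derive2_metric_sym k i l j Ux).
rewrite (christoffel_pairing_sym l i k j Ux) (christoffel_pairing_comm i l j k Ux).
rewrite (christoffel_pairing_sym k i l j Ux).
move: ('D_ _ _ _) ('D_ _ _ _) ('D_ _ _ _) ('D_ _ _ _).
by move: (christoffel_pairing _ _ _ _ _) (christoffel_pairing _ _ _ _ _) => *; ring.
Qed.

End LeviCivita.

(** * Linear forms and their values on the standard basis *)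

Section ScalarForms.
Variables (R : realType) (n : nat).
Implicit Types (f g : 'rV[R]_n -> R).

Lemma scalar_expand f u : scalar f -> f u = \sum_i u 0 i * f 'e_i.
Proof.
(* Bundling the linearity proof makes the generic lemmas on linear maps available for a bare
   function. *)
move=> lf; pose F : {scalar 'rV[R]_n} := HB.pack f (GRing.isLinear.Build _ _ _ _ f lf).
rewrite -[f]/(F : _ -> _) {1}(row_sum_delta u) linear_sum.
by apply: eq_bigr => i _; rewrite linearZ.
Qed.

Lemma scalar_ext f g : scalar f -> scalar g ->
  (forall i, f 'e_i = g 'e_i) -> f =1 g.
Proof.
move=> lf lg fg u; rewrite (scalar_expand u lf) (scalar_expand u lg).
by apply: eq_bigr => i _; rewrite fg.
Qed.

Lemma scalarN f : scalar f -> scalar (fun u => - f u).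
Proof. by move=> lf a u v; rewrite lf opprD mulrN. Qed.

Lemma scalar_sum (I : Type) (r : seq I) (F : I -> 'rV[R]_n -> R) :
  (forall i, scalar (F i)) -> scalar (fun u => \sum_(i <- r) F i u).
Proof.
move=> lF a u v; rewrite mulr_sumr -big_split /=.
by apply: eq_bigr => i _; rewrite lF.
Qed.

Lemma scalarZ f b : scalar f -> scalar (fun u => b * f u).
Proof. by move=> lf a u v; rewrite lf mulrDr mulrCA. Qed.

End ScalarForms.

(** * Multilinearity of the curvature at a point, and metric traces *)

Section CurvatureAlgebra.
Variables (R : realType) (n : nat) (G : 'rV[R]_n -> 'M[R]_n) (x : 'rV[R]_n).
Implicit Types (u v w z : 'rV[R]_n) (i j k l m p : 'I_n).

Local Notation inner := (inner G x).
Local Notation riemann := (riemann G x).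
Local Notation ricci := (ricci G x).
Local Notation S := (ricci_op G x).
Local Notation ricci2 := (ricci2 G x).
Local Notation gtrace := (gtrace G x).
Local Notation kappa := (scalar_curvature G x).

Lemma inner_scalarl v : scalar (inner ^~ v).
Proof. by move=> a u w; rewrite /Defs.inner !mulmxDl -!scalemxAl !mxE. Qed.

Lemma inner_scalarr u : scalar (inner u).
Proof. by move=> a v w; rewrite /Defs.inner linearP mulmxDr -scalemxAr !mxE. Qed.

Lemma innerBl u v w : inner (u - v) w = inner u w - inner v w.
Proof. by rewrite -scaleN1r addrC inner_scalarl mulN1r addrC. Qed.

Lemma inner0l v : inner 0 v = 0.
Proof. by rewrite /Defs.inner !mul0mx mxE. Qed.

Lemma innerZl c u w : inner (c *: u) w = c * inner u w.
Proof. by rewrite -[c *: u]addr0 inner_scalarl inner0l addr0. Qed.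

Lemma curvature_op_linear1 v w : linear (fun u => curvature_op G x u v w).
Proof.
move=> a u1 u2; rewrite /curvature_op.
do 3![rewrite scaler_sumr -big_split /=; apply: eq_bigr => ? _].
by rewrite scalerA -scalerDl !mxE; congr (_ *: _); ring.
Qed.

Lemma curvature_op_linear2 u w : linear (fun v => curvature_op G x u v w).
Proof.
move=> a v1 v2; rewrite /curvature_op.
do 3![rewrite scaler_sumr -big_split /=; apply: eq_bigr => ? _].
by rewrite scalerA -scalerDl !mxE; congr (_ *: _); ring.
Qed.

Lemma curvature_op_linear3 u v : linear (curvature_op G x u v).
Proof.
move=> a w1 w2; rewrite /curvature_op.
do 3![rewrite scaler_sumr -big_split /=; apply: eq_bigr => ? _].
by rewrite scalerA -scalerDl !mxE; congr (_ *: _); ring.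
Qed.

Lemma riemann_scalar1 v w z : scalar (fun u => riemann u v w z).
Proof. by move=> a u1 u2; rewrite /Defs.riemann curvature_op_linear1 inner_scalarl. Qed.

Lemma riemann_scalar2 u w z : scalar (fun v => riemann u v w z).
Proof. by move=> a v1 v2; rewrite /Defs.riemann curvature_op_linear2 inner_scalarl. Qed.

Lemma riemann_scalar3 u v z : scalar (fun w => riemann u v w z).
Proof. by move=> a w1 w2; rewrite /Defs.riemann curvature_op_linear3 inner_scalarl. Qed.

Lemma riemann_scalar4 u v w : scalar (riemann u v w).
Proof. exact: inner_scalarr. Qed.

Lemma gtrace_scalar (F : 'rV[R]_n -> 'rV[R]_n -> 'rV[R]_n -> R) :
  (forall a b, scalar (fun u => F u a b)) -> scalar (fun u => gtrace (F u)).
Proof.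
move=> lF; rewrite /Defs.gtrace; apply: scalar_sum => i; apply: scalar_sum => j.
exact: scalarZ.
Qed.

Lemma ricci_scalarl v : scalar (ricci ^~ v).
Proof.
apply: (@gtrace_scalar (fun u a b => riemann a u v b)) => a b.
exact: riemann_scalar2.
Qed.

Lemma ricci_scalarr u : scalar (ricci u).
Proof.
apply: (@gtrace_scalar (fun v a b => riemann a u v b)) => a b.
exact: riemann_scalar3.
Qed.

Lemma eq_gtrace (B B' : 'rV[R]_n -> 'rV[R]_n -> R) : B =2 B' -> gtrace B = gtrace B'.
Proof. by move=> BB; apply: eq_bigr => i _; apply: eq_bigr => j _; rewrite BB. Qed.

Lemma gtraceD (B B' : 'rV[R]_n -> 'rV[R]_n -> R) :
  gtrace (fun a b => B a b + B' a b) = gtrace B + gtrace B'.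
Proof.
rewrite -big_split; apply: eq_bigr => i _; rewrite -big_split.
by apply: eq_bigr => j _; rewrite mulrDr.
Qed.

Lemma gtraceZ (B : 'rV[R]_n -> 'rV[R]_n -> R) c :
  gtrace (fun a b => c * B a b) = c * gtrace B.
Proof.
rewrite /Defs.gtrace mulr_sumr; apply: eq_bigr => i _; rewrite mulr_sumr.
by apply: eq_bigr => j _; rewrite mulrCA.
Qed.

Lemma gtraceB (B B' : 'rV[R]_n -> 'rV[R]_n -> R) :
  gtrace (fun a b => B a b - B' a b) = gtrace B - gtrace B'.
Proof.
rewrite -[- gtrace B']mulN1r -gtraceZ -gtraceD.
by apply: eq_gtrace => a b; rewrite mulN1r.
Qed.

Hypothesis symG : (G x)^T = G x.
Hypothesis unitG : G x \in unitmx.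

Lemma inner_sym u v : inner u v = inner v u.
Proof.
have trE (M : 'M[R]_1) : M 0 0 = (M^T)%R 0 0 by rewrite mxE.
by rewrite /Defs.inner trE !trmx_mul trmxK symG mulmxA.
Qed.

Lemma invmx_metric_sym i j : invmx (G x) i j = invmx (G x) j i.
Proof. by rewrite -[in LHS]symG -trmx_inv mxE. Qed.

(** The version of [inner_sharp] for a form with an unbundled linearity proof, as needed for [ricci]
    and [projective]. *)
Lemma inner_sharp_scalar (alpha : 'rV[R]_n -> R) w :
  scalar alpha -> inner (sharp G x alpha) w = alpha w.
Proof.
move=> lalpha; rewrite (scalar_expand w lalpha) /Defs.inner /sharp mulmxKV //.
by rewrite mxE; apply: eq_bigr => i _; rewrite !mxE mulrC.
Qed.

Lemma inner_ricci_op u v : inner (S u) v = ricci u v.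
Proof. exact/inner_sharp_scalar/ricci_scalarr. Qed.

Lemma gtrace_swap (B : 'rV[R]_n -> 'rV[R]_n -> R) :
  gtrace (fun a b => B b a) = gtrace B.
Proof.
rewrite /Defs.gtrace exchange_big; apply: eq_bigr => i _; apply: eq_bigr => j _ /=.
by rewrite invmx_metric_sym.
Qed.

(** Lowering with [G x] and contracting with its inverse cancel, which leaves the ordinary trace.
    The identity gives [n], and the square of the Ricci operator gives [scalar_curvature2]. *)
Lemma gtrace_inner_op (f : 'rV[R]_n -> 'rV[R]_n) :
  gtrace (fun a b => inner (f a) b) = \sum_i f 'e_i 0 i.
Proof.
apply: eq_bigr => i _; rewrite -[in RHS](mulmxK unitG (f 'e_i)) [RHS]mxE.
apply: eq_bigr => j _; rewrite mulrC invmx_metric_sym; congr (_ * _).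
rewrite /Defs.inner mxE -[RHS](sum_delta (fun b => (f 'e_i *m G x) 0 b)).
by apply: eq_bigr => k _; rewrite mulrC; congr (_ * _); rewrite mxE.
Qed.

Lemma gtrace_inner : gtrace inner = n%:R.
Proof.
rewrite (gtrace_inner_op id) (eq_bigr (fun=> 1)) => [|i _].
  by rewrite sumr_const card_ord.
by rewrite mxE !eqxx.
Qed.

(** The form comes from the rank one operator sending [a] to [alpha a *: q], whose trace is
    [alpha q]. *)
Lemma gtrace_contract (alpha : 'rV[R]_n -> R) q : scalar alpha ->
  gtrace (fun a b => alpha a * inner b q) = alpha q.
Proof.
move=> lalpha; rewrite (scalar_expand q lalpha).
rewrite (@eq_gtrace _ (fun a b => inner (alpha a *: q) b)) => [|a b].
  by rewrite gtrace_inner_op; apply: eq_bigr => i _; rewrite mxE mulrC.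
by rewrite innerZl inner_sym.
Qed.

(** * Symmetries of the Riemann and Ricci tensors on arbitrary vectors *)

Hypothesis riemann_skew_basis : forall i j k l,
  riemann 'e_i 'e_j 'e_k 'e_l = - riemann 'e_i 'e_j 'e_l 'e_k.
Hypothesis riemann_pair_basis : forall i j k l,
  riemann 'e_i 'e_j 'e_k 'e_l = riemann 'e_k 'e_l 'e_i 'e_j.

(** Both sides are linear in each slot, so the basis identity extends one argument at a time. *)
Lemma riemann_skew34 u v w z : riemann u v w z = - riemann u v z w.
Proof.
apply: (scalar_ext (riemann_scalar1 v w z) (scalarN (riemann_scalar1 v z w))) => i.
apply: (scalar_ext (riemann_scalar2 _ w z) (scalarN (riemann_scalar2 _ z w))) => j.
apply: (scalar_ext (riemann_scalar3 _ _ z) (scalarN (riemann_scalar4 _ _ z))) => k.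
apply: (scalar_ext (riemann_scalar4 _ _ _) (scalarN (riemann_scalar3 _ _ _))) => l.
exact: riemann_skew_basis.
Qed.

Lemma riemann_pair u v w z : riemann u v w z = riemann w z u v.
Proof.
apply: (scalar_ext (riemann_scalar1 v w z) (riemann_scalar3 w z v)) => i.
apply: (scalar_ext (riemann_scalar2 _ w z) (riemann_scalar4 w z _)) => j.
apply: (scalar_ext (riemann_scalar3 _ _ z) (riemann_scalar1 z _ _)) => k.
apply: (scalar_ext (riemann_scalar4 _ _ _) (riemann_scalar2 _ _ _)) => l.
exact: riemann_pair_basis.
Qed.

(** After swapping the trace slots, pair symmetry also transports the skew symmetry of the last two
    slots to the first two. *)
Lemma ricci_sym u v : ricci u v = ricci v u.
Proof.
rewrite /Defs.ricci -gtrace_swap; apply: eq_gtrace => a b.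
rewrite (riemann_pair b) (riemann_skew34 v a) (riemann_pair v a).
by rewrite (riemann_skew34 u b) opprK riemann_pair.
Qed.

Lemma inner_ricci_opr u v : inner u (S v) = ricci u v.
Proof. by rewrite inner_sym inner_ricci_op ricci_sym. Qed.

Lemma ricci_ricci_op u v : ricci (S u) v = ricci2 u v.
Proof. by rewrite -inner_ricci_op. Qed.

Lemma ricci2_sym u v : ricci2 u v = ricci2 v u.
Proof. by rewrite -!ricci_ricci_op -!inner_ricci_opr inner_sym. Qed.

Lemma ricci_ricci_opr u v : ricci u (S v) = ricci2 u v.
Proof. by rewrite ricci_sym ricci_ricci_op ricci2_sym. Qed.

Lemma ricci2_scalarl v : scalar (ricci2 ^~ v).
Proof. by move=> a u w; rewrite !(ricci2_sym _ v) -!ricci_ricci_op ricci_scalarr. Qed.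

Lemma gtrace_ricci2 : gtrace ricci2 = scalar_curvature2 G x.
Proof.
rewrite (gtrace_inner_op (fun u => S (S u))) /scalar_curvature2.
by apply: eq_bigr => i _; rewrite !mxE.
Qed.

Lemma projective_scalar4 u v w : scalar (projective G x u v w).
Proof. by move=> a z1 z2; rewrite /projective riemann_scalar4 !inner_scalarr; ring. Qed.

(** * Algebraic consequences of the condition at a point *)

Variable L : R.
Hypothesis hPS : forall X1 X Y,
  projective_dot_ricci G x X1 X Y = L *: q_g_ricci G x X1 X Y.

(** The inner product of the condition with [X2]; self-adjointness of the Ricci operator moves its
    outer occurrences onto [X2]. *)
Lemma lowered_condition X1 X2 X Y :
  riemann X Y (S X1) X2 - riemann X Y X1 (S X2)
  - (n%:R - 1)^-1 * (ricci2 Y X1 * inner X X2 - ricci2 X X1 * inner Y X2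
                     - (ricci Y X1 * ricci X X2 - ricci X X1 * ricci Y X2))
  = L * (ricci Y X1 * inner X X2 - ricci X X1 * inner Y X2
         - (inner Y X1 * ricci X X2 - inner X X1 * ricci Y X2)).
Proof.
have := congr1 (inner ^~ X2) (hPS X1 X Y).
rewrite /projective_dot_ricci /q_g_ricci innerZl !innerBl /wedge_g.
rewrite !inner_ricci_op (ricci_sym (projective_op _ _ _ _ _)) -inner_ricci_op.
rewrite (inner_sym (S X2)) !inner_sharp_scalar; try exact: projective_scalar4.
have -> a b : ricci (a *: X - b *: Y) X2 = a * ricci X X2 - b * ricci Y X2.
  by rewrite -!inner_ricci_opr innerBl !innerZl.
rewrite !innerZl /projective !inner_ricci_opr !ricci_ricci_opr => E; apply: etrans E.
move: (riemann _ _ _ _) (riemann _ _ _ _) (ricci2 _ _) (ricci2 _ _).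
move: (ricci Y X1) (ricci X X1) (ricci Y X2) (ricci X X2) => *.
move: (inner _ _) (inner _ _) => *.
ring.
Qed.

Hypothesis n_gt1 : (1 < n)%N.

Lemma dim_neq0 : n%:R != 0 :> R.
Proof. by rewrite pnatr_eq0 -lt0n ltnW. Qed.

Lemma dim_sub1_neq0 : n%:R - 1 != 0 :> R.
Proof. by rewrite subr_eq0 pnatr_eq1 gtn_eqF. Qed.

Lemma ricci_wedge_ricci X1 X2 X3 X4 :
  kulkarni_nomizu ricci ricci X1 X2 X3 X4 = kulkarni_nomizu inner ricci2 X1 X2 X3 X4.
Proof.
have E1 := lowered_condition X3 X4 X1 X2.
have E2 := lowered_condition X4 X3 X1 X2.
(* Both instances now contain the same two curvature values, and their [L] terms agree, so the
   difference only involves [ricci], [ricci2] and [inner]. *)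
rewrite (riemann_skew34 X1 X2 (S X4)) (riemann_skew34 X1 X2 X4) in E2.
rewrite /kulkarni_nomizu.
move: E1 E2.
move: (riemann _ _ _ _) (riemann _ _ _ _) (ricci2 _ _) (ricci2 _ _).
move: (ricci2 _ _) (ricci2 _ _) (ricci _ _) (ricci _ _) (ricci _ _) (ricci _ _).
move: (inner _ _) (inner _ _) (inner _ _) (inner _ _) => *.
(* The difference of [E1] and [E2] is the goal multiplied by the inverse of [n%:R - 1]. *)
apply: (mulfI (invr_neq0 dim_sub1_neq0)).
lra.
Qed.

Lemma ricci2_eq X Y :
  n%:R * ricci2 X Y - 2 * kappa * ricci X Y
  + scalar_curvature2 G x * inner X Y = 0.
Proof.
(* The identity (i) with the contracted slots [a] and [b] outermost; mixed products are put in the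
   shape of [gtrace_contract]. *)
have E a b : 2 * ricci X Y * ricci a b - 2 * (ricci a Y * inner b (S X))
    = ricci2 X Y * inner a b + inner X Y * ricci2 a b
      - inner a Y * inner b (S (S X)) - ricci2 a Y * inner b X.
  have := ricci_wedge_ricci a X Y b; rewrite /kulkarni_nomizu.
  rewrite !inner_ricci_opr ricci_ricci_opr (ricci_sym b X) (inner_sym b X).
  rewrite (ricci2_sym b X).
  move: (ricci2 _ _) (ricci2 _ _) (ricci2 _ _) (ricci2 _ _).
  move: (ricci _ _) (ricci _ _) (ricci _ _) (ricci _ _).
  move: (inner _ _) (inner _ _) (inner _ _) (inner _ _) => *; lra.
have := eq_gtrace E.
rewrite !gtraceB gtraceD !gtraceZ gtrace_inner gtrace_ricci2.
rewrite (gtrace_contract _ (ricci_scalarl Y)) (gtrace_contract _ (inner_scalarl Y)).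
rewrite (gtrace_contract _ (ricci2_scalarl Y)) ricci_ricci_op inner_ricci_op.
rewrite ricci_ricci_op -[gtrace ricci]/kappa.
move: (ricci2 _ _) (ricci _ _) (inner _ _) (scalar_curvature2 _ _) kappa => *; lra.
Qed.

(** The trace of [ricci2_eq] is twice the relation between [n%:R * scalar_curvature2 G x] and
    [kappa ^+ 2]. *)
Lemma scalar_curvature2_eq : scalar_curvature2 G x = kappa ^+ 2 / n%:R.
Proof.
have := eq_gtrace (ricci2_eq).
rewrite gtraceD gtraceB !gtraceZ gtrace_ricci2 gtrace_inner.
have -> : gtrace (fun _ _ => 0) = 0.
  by rewrite -[RHS](mul0r (gtrace inner)) -gtraceZ; apply: eq_gtrace => a b; rewrite mul0r.
move: (scalar_curvature2 _ _) => k2; rewrite -[gtrace ricci]/kappa; move: kappa => k E.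
apply: (mulIf dim_neq0); rewrite divfK ?dim_neq0 // expr2.
by move: E; lra.
Qed.

Lemma ricci2_quadratic X Y :
  n%:R ^+ 2 * ricci2 X Y - 2 * n%:R * kappa * ricci X Y
  + kappa ^+ 2 * inner X Y = 0.
Proof.
have := ricci2_eq X Y; rewrite scalar_curvature2_eq => /(congr1 ( *%R n%:R)).
rewrite mulr0 => <-; rewrite !mulrDr mulrN expr2.
have -> : n%:R * (kappa ^+ 2 / n%:R * inner X Y) = kappa ^+ 2 * inner X Y.
  by rewrite mulrA mulrCA divff ?dim_neq0 // mulr1.
move: (ricci2 _ _) (ricci _ _) (inner _ _) kappa => *; ring.
Qed.

Lemma e_tensor_eq X Y :
  (n%:R - 1) * e_tensor G x X Y
  = L * (n%:R - 1) * kappa * inner X Y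
    + (kappa - L * (n%:R - 1) * n%:R) * ricci X Y - ricci2 X Y.
Proof.
pose c : R := (n%:R - 1)^-1.
(* Under the trace over [a] and [b], the first curvature term becomes [ricci2 X Y] and the second
   [e_tensor G x X Y]. *)
have E a b : riemann a X (S Y) b - riemann a X Y (S b)
  - c * (ricci2 X Y * inner a b - ricci2 a Y * inner b X
         - (ricci X Y * ricci a b - ricci a Y * inner b (S X)))
  = L * (ricci X Y * inner a b - ricci a Y * inner b X
         - (inner X Y * ricci a b - inner a Y * inner b (S X))).
  rewrite inner_ricci_opr (ricci_sym b X) (inner_sym b X).
  exact: lowered_condition.
have {E} := eq_gtrace E.
rewrite !(gtraceB, gtraceZ) gtrace_inner -[gtrace ricci]/kappa.
rewrite !(gtrace_contract _ (ricci_scalarl Y)) (gtrace_contract _ (inner_scalarl Y)).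
rewrite (gtrace_contract _ (ricci2_scalarl Y)) ricci_ricci_op inner_ricci_op.
rewrite -[gtrace (fun a b => riemann a X (S Y) b)]/(ricci X (S Y)) ricci_ricci_opr.
rewrite -[gtrace (fun a b => riemann a X Y (S b))]/(e_tensor G x X Y).
have : (n%:R - 1) * c = 1 by rewrite divff ?dim_sub1_neq0.
move: (ricci2 _ _) (ricci _ _) (inner _ _) (e_tensor _ _ _ _) kappa c (n%:R) => s r g e k d m md E.
(* The left side of [E] is isolated as a subterm so that [E] can be rewritten; [md] then removes the
   factor [(m - 1) * d]. *)
have -> : (m - 1) * e = (m - 1) * s - (m - 1) * d * (s * m - s - (r * k - s))
   - (m - 1) * (s - e - d * (s * m - s - (r * k - s))) by ring.
by rewrite E md; ring.
Qed.

Lemma ricci_einstein X Y : (forall v, v != 0 -> 0 < inner v v) ->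
  ricci X Y = kappa / n%:R * inner X Y.
Proof.
move=> pos; pose N := n%:R *: S X - kappa *: X.
(* By self-adjointness of the Ricci operator this is the quadratic relation evaluated at
   [(X, X)]. *)
have NN : inner N N = 0.
  rewrite -(ricci2_quadratic X X) {1}/N innerBl !innerZl !(inner_sym _ N).
  rewrite /N !innerBl !innerZl !inner_ricci_op !inner_ricci_opr ricci_ricci_opr.
  move: (ricci2 _ _) (ricci _ _) (inner _ _) kappa => *; ring.
have N0 : N = 0.
  by apply/eqP; apply: contra_eqT NN => /pos; rewrite lt0r => /andP[].
have := congr1 (inner ^~ Y) N0; rewrite /N innerBl !innerZl inner_ricci_op.
rewrite inner0l => /eqP; rewrite subr_eq0 => /eqP E.
by apply: (mulfI dim_neq0); rewrite E mulrA mulrCA divff ?dim_neq0 // mulr1.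
Qed.

End CurvatureAlgebra.

(** * From a single chart to the manifold *)

Unset Implicit Arguments.

Theorem theorem4p12 (R : realType) (n : nat) (hn : (3 <= n)%N)
  (M : topologicalType) (A : smooth_manifold R n M)
  (g : semi_riemannian_metric A)
  (L : M -> R) (hL : smooth_function A L)
  (hPS : forall c p, atlas A c -> chart_dom c p -> forall X1 X Y : 'rV[R]_n,
    projective_dot_ricci (g c) (c p) X1 X Y
    = L p *: q_g_ricci (g c) (c p) X1 X Y) :
  [/\ (* (i) *)
      forall c p, atlas A c -> chart_dom c p ->
      forall X1 X2 X3 X4 : 'rV[R]_n,
        kulkarni_nomizu (ricci (g c) (c p)) (ricci (g c) (c p)) X1 X2 X3 X4
        = kulkarni_nomizu (inner (g c) (c p)) (ricci2 (g c) (c p)) X1 X2 X3 X4,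
      (* (ii) *)
      [/\ forall c p, atlas A c -> chart_dom c p -> forall X Y : 'rV[R]_n,
            n%:R ^+ 2 * ricci2 (g c) (c p) X Y
            - 2 * n%:R * scalar_curvature (g c) (c p) * ricci (g c) (c p) X Y
            + scalar_curvature (g c) (c p) ^+ 2 * inner (g c) (c p) X Y = 0,
          forall c p, atlas A c -> chart_dom c p ->
            scalar_curvature2 (g c) (c p)
            = scalar_curvature (g c) (c p) ^+ 2 / n%:R
        & riemannian g -> einstein g]
    & (* (iii) *)
      forall c p, atlas A c -> chart_dom c p -> forall X Y : 'rV[R]_n,
        (n%:R - 1) * e_tensor (g c) (c p) X Y
        = L p * (n%:R - 1) * scalar_curvature (g c) (c p)
            * inner (g c) (c p) X Y
          + (scalar_curvature (g c) (c p) - L p * (n%:R - 1) * n%:R)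
            * ricci (g c) (c p) X Y
          - ricci2 (g c) (c p) X Y].
Proof.
have chartU (c : chart R n M) (p : M) : chart_dom c p -> chart_img c (c p).
  by move=> cp; exists p.
have openU (c : chart R n M) : open (chart_img c) by exact: chart_img_open.
have sym c p (Ac : atlas A c) (cp : chart_dom c p) := Defs.metric_sym g Ac (chartU c p cp).
have unit c p (Ac : atlas A c) (cp : chart_dom c p) := Defs.metric_nondeg g Ac (chartU c p cp).
(* The curvature symmetries use the metric on the whole chart image; the rest only uses tensors at
   the point [c p]. *)
have skew c p (Ac : atlas A c) (cp : chart_dom c p) i j k l :=
  riemann_skew_coord (openU c) (fun x => Defs.metric_sym g Ac)
    (fun x => metric_nondeg g Ac) (metric_smooth g Ac) i j k l (chartU c p cp).
have pair c p (Ac : atlas A c) (cp : chart_dom c p) i j k l :=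
  riemann_pair_coord (openU c) (fun x => Defs.metric_sym g Ac)
    (fun x => metric_nondeg g Ac) (metric_smooth g Ac) i j k l (chartU c p cp).
(* This makes both [n] and [n - 1] nonzero in [R]. *)
have n1 : (1 < n)%N by exact: ltnW.
split=> [c p Ac cp X1 X2 X3 X4||c p Ac cp X Y].
- exact: (ricci_wedge_ricci (sym c p Ac cp) (unit c p Ac cp) (skew c p Ac cp)
    (pair c p Ac cp) (hPS c p Ac cp) n1).
- split=> [c p Ac cp X Y|c p Ac cp|pos c p Ac cp X Y].
  + exact: (ricci2_quadratic (sym c p Ac cp) (unit c p Ac cp) (skew c p Ac cp)
      (pair c p Ac cp) (hPS c p Ac cp) n1).
  + exact: (scalar_curvature2_eq (sym c p Ac cp) (unit c p Ac cp) (skew c p Ac cp)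
      (pair c p Ac cp) (hPS c p Ac cp) n1).
  + exact: (ricci_einstein (sym c p Ac cp) (unit c p Ac cp) (skew c p Ac cp)
      (pair c p Ac cp) (hPS c p Ac cp) n1 X Y (pos c p Ac cp)).
- exact: (e_tensor_eq (sym c p Ac cp) (unit c p Ac cp) (skew c p Ac cp)
    (pair c p Ac cp) (hPS c p Ac cp) n1).
Qed.
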